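(* Let $A$ and $B$ be unital Banach algebras with units $1_A$ and $1_B$, let $M$ be a unital Banach $A$-$B$-bimodule, let $\mathcal{T}=\begin{bmatrix}A&M\\0&B\end{bmatrix}$ be the associated triangular Banach algebra, and let $X$ be a unital Banach $\mathcal{T}$-bimodule. Put $X_{AA}=1_AX1_A$, $X_{BB}=1_BX1_B$ and $X_{AB}=1_AX1_B$. If $X_{AB}=0$, then for all $n\ge 0$ $$H^n(\mathcal{T},X)\simeq H^n(A,X_{AA})\oplus H^n(B,X_{BB}).$$
   Context: Triangular Banach algebra: for unital Banach algebras $A,B$ and a unital Banach $A$-$B$-bimodule $M$, $\mathcal{T}=\begin{bmatrix}A&M\\0&B\end{bmatrix}$ is the set of matrices $\begin{bmatrix}a&m\\0&b\end{bmatrix}$ ($a\in A$, $m\in M$, $b\in B$) with the usual $2\times 2$ matrix addition and formal matrix multiplication and the norm $\left\|\begin{bmatrix}a&m\\0&b\end{bmatrix}\right\|=\|a\|+\|m\|+\|b\|$. $A$ and $B$ are identified with the diagonal corners of $\mathcal{T}$; in particular $1_A$ and $1_B$ are identified with $\begin{bmatrix}1_A&0\\0&0\end{bmatrix}$ and $\begin{bmatrix}0&0\\0&1_B\end{bmatrix}$. Thus for a unital Banach $\mathcal{T}$-bimodule $X$, the space $X_{AA}=1_AX1_A$ is a Banach $A$-bimodule and $X_{BB}=1_BX1_B$ is a Banach $B$-bimodule by restricting the $\mathcal{T}$-actions. Cohomology: for a Banach algebra $D$ and a Banach $D$-bimodule $Y$, let $C^0(D,Y)=Y$ and, for $n\ge1$,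 let $C^n(D,Y)$ be the Banach space of all bounded $n$-linear maps $D\times\cdots\times D\to Y$. Let $\delta^0 y(a)=ay-ya$ and, for $n\ge 1$, $$\delta^nf(a_1,\dots,a_{n+1})=a_1f(a_2,\dots,a_{n+1})+\sum_{k=1}^n(-1)^kf(a_1,\dots,a_{k-1},a_ka_{k+1},\dots,a_{n+1})+(-1)^{n+1}f(a_1,\dots,a_n)a_{n+1}.$$ Then $H^n(D,Y)=\operatorname{Ker}\delta^n/\operatorname{Im}\delta^{n-1}$ (with $\operatorname{Im}\delta^{-1}=0$). The symbol $\simeq$ denotes isomorphism of linear spaces. *)

(* Defs.v *)
From HB Require Import structures.
From mathcomp Require Import all_boot all_order all_algebra.
From mathcomp Require Import boolp classical_sets functions topology normedtype.
From mathcomp Require Import ring.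

Set Implicit Arguments.
Unset Strict Implicit.
Unset Printing Implicit Defensive.

Import Order.TTheory GRing.Theory Num.Theory.
Import numFieldNormedType.Exports.

Local Open Scope classical_set_scope.
Local Open Scope ring_scope.

(* Unital Banach algebras. The product is a new operation because MathComp
   cannot join its ring structures with normed modules: the declared join of
   rings and normed Z-modules is [numDomainType]. The norm of the unit is not
   required to be 1: the unit of the triangular algebra below has norm
   |1_A| + |1_B|. *)
HB.mixin Record isBanachAlgebra (K : numFieldType) A
    of CompleteNormedModule K A := {
  bmul : A -> A -> A;
  bone : A;
  bmul_linearl : forall y, linear (bmul^~ y);
  bmul_linearr : forall x, linear (bmul x);
  bmulA : associative bmul;
  bmul1l : left_id bone bmul;
  bmul1r : right_id bone bmul;
  ler_norm_bmul : forall x y, `|bmul x y| <= `|x| * `|y|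
}.

#[short(type="banachAlgType")]
HB.structure Definition BanachAlgebra (K : numFieldType) :=
  {A of CompleteNormedModule K A & isBanachAlgebra K A}.

Arguments bone {K s}.

HB.mixin Record isBanachBimodule (K : numFieldType) (A B : banachAlgType K) X
    of CompleteNormedModule K X := {
  lact : A -> X -> X;
  ract : X -> B -> X;
  lact_linearl : forall x, linear (lact^~ x);
  lact_linearr : forall a, linear (lact a);
  ract_linearl : forall b, linear (ract^~ b);
  ract_linearr : forall x, linear (ract x);
  lactM : forall a a' x, lact (bmul a a') x = lact a (lact a' x);
  ractM : forall x b b', ract x (bmul b b') = ract (ract x b) b';
  lactA : forall a x b, lact a (ract x b) = ract (lact a x) b;
  ler_norm_lact : forall a x, `|lact a x| <= `|a| * `|x|;
  ler_norm_ract : forall x b, `|ract x b| <= `|x| * `|b|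
}.

#[short(type="banachBimodType")]
HB.structure Definition BanachBimodule (K : numFieldType)
    (A B : banachAlgType K) :=
  {X of CompleteNormedModule K X & isBanachBimodule K A B X}.

HB.mixin Record isUnitalBimodule (K : numFieldType) (A B : banachAlgType K) X
    of BanachBimodule K A B X := {
  lact1 : forall x : X, lact (bone : A) x = x;
  ract1 : forall x : X, ract x (bone : B) = x
}.

#[short(type="unitalBanachBimodType")]
HB.structure Definition UnitalBanachBimodule (K : numFieldType)
    (A B : banachAlgType K) :=
  {X of BanachBimodule K A B X & isUnitalBimodule K A B X}.

Section BimoduleTheory.
Variables (K : numFieldType) (A B : banachAlgType K).

Let linD (U V : lmodType K) (f : U -> V) : linear f -> {morph f : x y / x + y}.
Proof. by move=> fl x y; have := fl 1 x y; rewrite !scale1r. Qed.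
Let lin0 (U V : lmodType K) (f : U -> V) : linear f -> f 0 = 0.
Proof.
by move=> fl; have := fl (-1) 0 0; rewrite scaler0 addr0 scaleN1r addNr.
Qed.
Let linZ (U V : lmodType K) (f : U -> V) : linear f ->
  forall k, {morph f : x / k *: x}.
Proof. by move=> fl k x; have := fl k x 0; rewrite !addr0 lin0// addr0. Qed.

Lemma bmul0r (x : A) : bmul x 0 = 0. Proof. exact/lin0/bmul_linearr. Qed.
Lemma bmul0l (x : A) : bmul 0 x = 0.
Proof. exact: lin0 (bmul_linearl x). Qed.

Variable X : banachBimodType A B.
Implicit Types (a : A) (b : B) (x y : X).

Lemma lact0r a : lact a (0 : X) = 0. Proof. exact/lin0/lact_linearr. Qed.
Lemma lact0l x : lact 0 x = 0. Proof. exact: lin0 (lact_linearl x). Qed.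
Lemma ract0r x : ract x 0 = 0. Proof. exact/lin0/ract_linearr. Qed.
Lemma ract0l b : ract (0 : X) b = 0. Proof. exact: lin0 (ract_linearl b). Qed.
Lemma lactDr a : {morph lact a : x y / x + y :> X}.
Proof. exact/linD/lact_linearr. Qed.
Lemma lactDl x : {morph lact^~ x : a a' / a + a'}.
Proof. exact: linD (lact_linearl x). Qed.
Lemma ractDr x : {morph ract x : b b' / b + b'}.
Proof. exact/linD/ract_linearr. Qed.
Lemma ractDl b : {morph ract^~ b : x y / x + y :> X}.
Proof. exact: linD (ract_linearl b). Qed.
Lemma lactZr a k : {morph lact a : x / k *: x :> X}.
Proof. exact/linZ/lact_linearr. Qed.
Lemma lactZl x k : {morph lact^~ x : a / k *: a}.
Proof. exact: linZ (lact_linearl x) k. Qed.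
Lemma ractZr x k : {morph ract x : b / k *: b}.
Proof. exact/linZ/ract_linearr. Qed.
Lemma ractZl b k : {morph ract^~ b : x / k *: x :> X}.
Proof. exact: linZ (ract_linearl b) k. Qed.

End BimoduleTheory.

Record triangular (K : numFieldType) (A B : banachAlgType K)
    (M : unitalBanachBimodType A B) :=
  TriMx { ulmx : A; urmx : M; lrmx : B }.
Arguments TriMx {K A B M}.
Arguments ulmx {K A B M}.
Arguments urmx {K A B M}.
Arguments lrmx {K A B M}.

Section Triangular.
Variables (K : numFieldType) (A B : banachAlgType K).
Variable M : unitalBanachBimodType A B.
Local Notation T := (triangular M).
Implicit Types s t u : T.

HB.instance Definition _ := gen_eqMixin T.
HB.instance Definition _ := gen_choiceMixin T.

Definition tri_add s t :=
  TriMx (ulmx s + ulmx t) (urmx s + urmx t) (lrmx s + lrmx t).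
Definition tri_opp t := TriMx (- ulmx t) (- urmx t) (- lrmx t).
Definition tri_scale (k : K) t :=
  TriMx (k *: ulmx t) (k *: urmx t) (k *: lrmx t).
Definition tri_norm t : K := `|ulmx t| + `|urmx t| + `|lrmx t|.
Definition tri_one : T := TriMx bone 0 bone.
Definition tri_mul s t :=
  TriMx (bmul (ulmx s) (ulmx t))
        (lact (ulmx s) (urmx t) + ract (urmx s) (lrmx t))
        (bmul (lrmx s) (lrmx t)).

Fact tri_addA : associative tri_add.
Proof. by move=> [a m b] [a' m' b'] [c p d]; rewrite /tri_add /= !addrA. Qed.
Fact tri_addC : commutative tri_add.
Proof.
by move=> [a m b] [a' m' b']; congr TriMx; exact: addrC.
Qed.
Fact tri_add0 : left_id (TriMx 0 0 0) tri_add.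
Proof. by move=> [a m b]; rewrite /tri_add /= !add0r. Qed.
Fact tri_addN : left_inverse (TriMx 0 0 0) tri_opp tri_add.
Proof. by move=> [a m b]; rewrite /tri_add /= !addNr. Qed.

HB.instance Definition _ :=
  GRing.isZmodule.Build T tri_addA tri_addC tri_add0 tri_addN.

Fact tri_scaleA a b t : tri_scale a (tri_scale b t) = tri_scale (a * b) t.
Proof. by case: t => x m y; rewrite /tri_scale /= !scalerA. Qed.
Fact tri_scale1 : left_id 1 tri_scale.
Proof. by move=> [x m y]; rewrite /tri_scale /= !scale1r. Qed.
Fact tri_scaleDr : right_distributive tri_scale +%R.
Proof. by move=> k [a m b] [a' m' b']; congr TriMx; exact: scalerDr. Qed.
Fact tri_scaleDl t : {morph tri_scale^~ t : a b / a + b}.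
Proof. by move=> a b; case: t => x m y; congr TriMx; exact: scalerDl. Qed.

HB.instance Definition _ := GRing.Zmodule_isLmodule.Build K T
  tri_scaleA tri_scale1 tri_scaleDr tri_scaleDl.

Fact ler_tri_normD s t : tri_norm (s + t) <= tri_norm s + tri_norm t.
Proof.
rewrite /tri_norm /= [leRHS]addrACA [X in _ <= X + _]addrACA.
by rewrite !lerD// ler_normD.
Qed.
Fact tri_normZ (k : K) t : tri_norm (k *: t) = `|k| * tri_norm t.
Proof. by rewrite /tri_norm /= !normrZ !mulrDr. Qed.
Fact tri_norm0_eq0 t : tri_norm t = 0 -> t = 0.
Proof.
case: t => a m b /eqP; rewrite /tri_norm /= !paddr_eq0 ?addr_ge0//.
by rewrite !normr_eq0 => /andP[/andP[/eqP-> /eqP->] /eqP->].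
Qed.

HB.instance Definition _ := Lmodule_isNormed.Build K T
  ler_tri_normD tri_normZ tri_norm0_eq0.

Lemma tri_normE t : `|t| = `|ulmx t| + `|urmx t| + `|lrmx t|.
Proof. by []. Qed.

Fact tri_complete (F : set_system T) : ProperFilter F -> cauchy F -> cvg F.
Proof.
move=> FF /cauchy_ballP Fc.
have aux (V : completeNormedModType K) (g : T -> V) :
    (forall s t, `|g s - g t| <= `|s - t|) -> cvg (g @ F).
  move=> gle; apply: cauchy_cvg; apply/cauchy_ballP => e e0.
  have := Fc e e0; rewrite !near_simpl => /= h.
  rewrite near_map2; apply: filterS h => -[s t] /=.
  rewrite -!ball_normE /=; exact: le_lt_trans.
have Ca : cvg ((ulmx : T -> A) @ F).
  by apply: aux => s t; rewrite [leRHS]tri_normE -addrA lerDl addr_ge0.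
have Cm : cvg ((urmx : T -> M) @ F).
  by apply: aux => s t; rewrite [leRHS]tri_normE addrAC lerDr addr_ge0.
have Cb : cvg ((lrmx : T -> B) @ F).
  by apply: aux => s t; rewrite [leRHS]tri_normE lerDr addr_ge0.
apply/cvg_ex; exists (TriMx (lim ((ulmx : T -> A) @ F))
  (lim ((urmx : T -> M) @ F)) (lim ((lrmx : T -> B) @ F))).
apply/cvgrPdist_lt => e e0; have e3 : 0 < e / 3%:R by rewrite divr_gt0.
move/cvgrPdist_lt : Ca => /(_ _ e3) Ca.
move/cvgrPdist_lt : Cm => /(_ _ e3) Cm.
move/cvgrPdist_lt : Cb => /(_ _ e3) Cb.
near=> t; rewrite tri_normE /=.
have -> : e = e / 3%:R + e / 3%:R + e / 3%:R.
  by field.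
by rewrite !ltrD//; near: t.
Unshelve. all: by end_near. Qed.

HB.instance Definition _ := Uniform_isComplete.Build T tri_complete.

Fact tri_mul_linearl t : linear (tri_mul^~ t).
Proof.
move=> k s s'; congr TriMx; rewrite /= ?bmul_linearl //.
by rewrite lact_linearl ract_linearl scalerDr addrACA.
Qed.
Fact tri_mul_linearr s : linear (tri_mul s).
Proof.
move=> k t t'; congr TriMx; rewrite /= ?bmul_linearr //.
by rewrite lact_linearr ract_linearr scalerDr addrACA.
Qed.

Fact tri_mulA : associative tri_mul.
Proof.
move=> s t u; congr TriMx; rewrite /= ?bmulA //.
by rewrite lactDr ractDl lactM ractM lactA addrA.
Qed.
Fact tri_mul1l : left_id tri_one tri_mul.
Proof.
by move=> [a m b]; rewrite /tri_mul /= !bmul1l lact1 ract0l addr0.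
Qed.
Fact tri_mul1r : right_id tri_one tri_mul.
Proof.
by move=> [a m b]; rewrite /tri_mul /= !bmul1r ract1 lact0r add0r.
Qed.
Fact ler_tri_mul s t : `|tri_mul s t| <= `|s| * `|t|.
Proof.
rewrite !tri_normE /=.
apply: (@le_trans _ _ (`|ulmx s| * `|ulmx t| +
    (`|ulmx s| * `|urmx t| + `|urmx s| * `|lrmx t|) + `|lrmx s| * `|lrmx t|)).
  rewrite !lerD ?ler_norm_bmul//.
  by rewrite (le_trans (ler_normD _ _))// lerD ?ler_norm_lact ?ler_norm_ract.
set a := `|ulmx s|; set m := `|urmx s|; set b := `|lrmx s|.
set a' := `|ulmx t|; set m' := `|urmx t|; set b' := `|lrmx t|.
have -> : (a + m + b) * (a' + m' + b') =
  a * a' + (a * m' + m * b') + b * b' + (a * b' + m * a' + m * m' + b * a' + b * m').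
  by ring.
by rewrite lerDl; do !apply: addr_ge0; rewrite mulr_ge0// normr_ge0.
Qed.

HB.instance Definition _ := isBanachAlgebra.Build K T tri_mul_linearl
  tri_mul_linearr tri_mulA tri_mul1l tri_mul1r ler_tri_mul.

End Triangular.

(* Contractive homomorphisms, not assumed to preserve the units: the embeddings
   of A and B as diagonal corners of the triangular algebra do not. *)
Record banachHom (K : numFieldType) (A D : banachAlgType K) := BanachHom {
  bhom :> A -> D;
  bhom_linear : linear bhom;
  bhomM : {morph bhom : x y / bmul x y};
  ler_norm_bhom : forall x, `|bhom x| <= `|x|
}.

(* For e := phi 1_A, the Banach A-bimodule e X e, on which A acts through
   phi. *)
Section Corner.
Variables (K : numFieldType) (A D : banachAlgType K).
Variables (phi : banachHom A D) (X : banachBimodType D D).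
Local Notation e := (phi bone).

Definition corner_set : set X := [set ract (lact e x) e | x in setT].
Definition corner_pred : pred X := fun x => x \in corner_set.

Lemma cornerP x : reflect (lact e x = x /\ ract x e = x) (corner_pred x).
Proof.
have ee : bmul e e = e by rewrite -bhomM bmul1l.
apply: (iffP idP); first by move=> /set_mem[y _ <-];
  rewrite lactA -lactM -ractM !ee.
by case=> ex xe; apply/mem_set; exists x; rewrite // ex.
Qed.

Fact corner_subsemimod_closed : GRing.subsemimod_closed corner_pred.
Proof.
split; [split|]; first by apply/cornerP; rewrite lact0r ract0l.
  by move=> x y /cornerP[ex xe] /cornerP[ey ye]; apply/cornerP;
    rewrite lactDr ractDl ex xe ey ye.
by move=> k x /cornerP[ex xe]; apply/cornerP; rewrite lactZr ractZl ex xe.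
Qed.

HB.instance Definition _ :=
  GRing.isSubmodClosed.Build K X corner_pred corner_subsemimod_closed.

Record corner := Corner { corner_val :> X; corner_valP : corner_pred corner_val }.

HB.instance Definition _ := [isSub for corner_val].
HB.instance Definition _ := [Choice of corner by <:].
HB.instance Definition _ := [SubChoice_isSubLmodule of corner by <:].

Implicit Types x y : corner.

Fact ler_corner_normD x y : `|val (x + y)| <= `|val x| + `|val y|.
Proof. exact: ler_normD. Qed.
Fact corner_normZ (k : K) x : `|val (k *: x)| = `|k| * `|val x|.
Proof. exact: normrZ. Qed.
Fact corner_norm0_eq0 x : `|val x| = 0 -> x = 0.
Proof. by move=> /normr0_eq0 x0; apply: val_inj. Qed.

HB.instance Definition _ := Lmodule_isNormed.Build K corner
  ler_corner_normD corner_normZ corner_norm0_eq0.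

Lemma corner_normE x : `|x| = `|val x|.
Proof. by []. Qed.

Fact corner_complete (F : set_system corner) :
  ProperFilter F -> cauchy F -> cvg F.
Proof.
move=> FF /cauchy_ballP Fc.
have : cvg ((val : corner -> X) @ F).
  apply: cauchy_cvg; apply/cauchy_ballP => r r0.
  have := Fc r r0; rewrite !near_simpl => /= h.
  by rewrite near_map2; apply: filterS h => -[x y] /=; rewrite -!ball_normE.
move=> /cvg_ex[x /cvgrPdist_lt Fx].
have fixx (f : X -> X) : {morph f : y z / y + z} ->
    (forall z, `|f z| <= `|e| * `|z|) -> (forall y : corner, f (val y) = val y) ->
    f x = x.
  move=> fD fle fid; apply/eqP; rewrite -subr_eq0 -normr_eq0.
  apply: contraT => fx0.
  have {}fx0 : 0 < `|f x - x| by rewrite lt_def fx0 normr_ge0.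
  have e1 : 0 < `|e| + 1 by rewrite ltr_wpDl.
  near F => y.
  have : `|x - val y| < `|f x - x| / (`|e| + 1).
    by near: y; apply: Fx; rewrite divr_gt0.
  rewrite ltr_pdivlMr// => xy.
  suff : `|f x - x| < `|f x - x| by rewrite ltxx.
  apply: le_lt_trans xy; rewrite mulrC mulrDl mul1r.
  have -> : f x - x = f (x - val y) - (x - val y).
    have -> : f x = f (x - val y) + val y.
      by rewrite -{2}(fid y) -fD subrK.
    by rewrite opprB addrA.
  by rewrite (le_trans (ler_normB _ _))// lerD.
have xcor : corner_pred x.
  apply/cornerP; split.
    apply: fixx => [||y]; [exact: lactDr|exact: ler_norm_lact|].
    by have /cornerP[] := corner_valP y.
  apply: (fixx (ract^~ e)) => [|z|y]; first exact: ractDl.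
    by rewrite mulrC ler_norm_ract.
  by have /cornerP[] := corner_valP y.
by apply/cvg_ex; exists (Corner xcor); apply/cvgrPdist_lt => r /Fx.
Unshelve. all: by end_near. Qed.

HB.instance Definition _ := Uniform_isComplete.Build corner corner_complete.

Fact corner_lact_subproof (a : A) x : corner_pred (lact (phi a) (val x)).
Proof.
case: x => x /= /cornerP[ex xe]; apply/cornerP; split.
  by rewrite -lactM -bhomM bmul1l.
by rewrite -lactA xe.
Qed.
Fact corner_ract_subproof x (a : A) : corner_pred (ract (val x) (phi a)).
Proof.
case: x => x /= /cornerP[ex xe]; apply/cornerP; split; first by rewrite lactA ex.
by rewrite -ractM -bhomM bmul1r.
Qed.

Definition corner_lact a x : corner := Corner (corner_lact_subproof a x).
Definition corner_ract x a : corner := Corner (corner_ract_subproof x a).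

Fact corner_lact_linearl x : linear (corner_lact^~ x).
Proof.
by move=> k a a'; apply: val_inj; rewrite /= bhom_linear lact_linearl.
Qed.
Fact corner_lact_linearr a : linear (corner_lact a).
Proof. by move=> k x y; apply: val_inj; rewrite /= lact_linearr. Qed.
Fact corner_ract_linearl a : linear (corner_ract^~ a).
Proof. by move=> k x y; apply: val_inj; rewrite /= ract_linearl. Qed.
Fact corner_ract_linearr x : linear (corner_ract x).
Proof.
by move=> k a a'; apply: val_inj; rewrite /= bhom_linear ract_linearr.
Qed.
Fact corner_lactM a a' x :
  corner_lact (bmul a a') x = corner_lact a (corner_lact a' x).
Proof. by apply: val_inj; rewrite /= bhomM lactM. Qed.
Fact corner_ractM x a a' :
  corner_ract x (bmul a a') = corner_ract (corner_ract x a) a'.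
Proof. by apply: val_inj; rewrite /= bhomM ractM. Qed.
Fact corner_lactA a x a' :
  corner_lact a (corner_ract x a') = corner_ract (corner_lact a x) a'.
Proof. by apply: val_inj; rewrite /= lactA. Qed.
Fact ler_corner_lact a x : `|corner_lact a x| <= `|a| * `|x|.
Proof.
rewrite !corner_normE /= (le_trans (ler_norm_lact _ _))//.
by rewrite ler_wpM2r ?ler_norm_bhom.
Qed.
Fact ler_corner_ract x a : `|corner_ract x a| <= `|x| * `|a|.
Proof.
rewrite !corner_normE /= (le_trans (ler_norm_ract _ _))//.
by rewrite ler_wpM2l ?ler_norm_bhom.
Qed.

HB.instance Definition _ := isBanachBimodule.Build K A A corner
  corner_lact_linearl corner_lact_linearr corner_ract_linearl
  corner_ract_linearr corner_lactM corner_ractM corner_lactA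
  ler_corner_lact ler_corner_ract.

End Corner.

Section CornerEmbeddings.
Variables (K : numFieldType) (A B : banachAlgType K).
Variable M : unitalBanachBimodType A B.
Local Notation T := (triangular M).

Definition inA (a : A) : T := TriMx a 0 0.
Definition inB (b : B) : T := TriMx 0 0 b.

Fact inA_linear : linear inA.
Proof. by move=> k a a'; congr TriMx; rewrite /= scaler0 addr0. Qed.
Fact inB_linear : linear inB.
Proof. by move=> k a a'; congr TriMx; rewrite /= scaler0 addr0. Qed.
Fact inA_mul : {morph inA : a a' / bmul a a'}.
Proof.
by move=> a a'; congr TriMx; rewrite /= ?lact0r ?ract0l ?bmul0r ?addr0.
Qed.
Fact inB_mul : {morph inB : b b' / bmul b b'}.
Proof.
by move=> b b'; congr TriMx; rewrite /= ?lact0r ?ract0l ?bmul0r ?addr0.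
Qed.
Fact ler_norm_inA a : `|inA a| <= `|a|.
Proof. by rewrite tri_normE /= !normr0 !addr0. Qed.
Fact ler_norm_inB b : `|inB b| <= `|b|.
Proof. by rewrite tri_normE /= !normr0 !add0r. Qed.

Definition embA : banachHom A T := BanachHom inA_linear inA_mul ler_norm_inA.
Definition embB : banachHom B T := BanachHom inB_linear inB_mul ler_norm_inB.

End CornerEmbeddings.

Section Cochains.
Variables (K : numFieldType) (D : banachAlgType K) (Y : banachBimodType D D).

(* [dfwith v x] is [v] with its i-th entry replaced by [x]. *)
Definition multilinear n (f : ('I_n -> D) -> Y) :=
  forall (v : 'I_n -> D) (i : 'I_n), linear (fun x : D => f (dfwith v (i := i) x)).

Definition bounded_multi n (f : ('I_n -> D) -> Y) :=
  exists2 C : K, 0 <= C & forall v, `|f v| <= C * \prod_(i < n) `|v i|.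

Definition bmlin_pred n : pred (('I_n -> D) -> Y) :=
  fun f => `[< multilinear f /\ bounded_multi f >].

Fact bmlin_subsemimod_closed n : GRing.subsemimod_closed (@bmlin_pred n).
Proof.
split; [split|].
- apply/asboolP; split; first by move=> v i k x y; rewrite /= scaler0 addr0.
  by exists 0 => // v; rewrite normr0 mul0r.
- move=> f g /asboolP[fl [C C0 fC]] /asboolP[gl [C' C'0 gC]]; apply/asboolP; split.
    by move=> v i k x y; rewrite !addrfctE fl gl scalerDr addrACA.
  exists (C + C') => [|v]; first by rewrite addr_ge0.
  rewrite mulrDl addrfctE.
  by rewrite (le_trans (ler_normD _ _))// lerD.
- move=> k f /asboolP[fl [C C0 fC]]; apply/asboolP; split.
    move=> v i c x y; rewrite !scalrfctE fl scalerDr !scalerA.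
    by rewrite (mulrC c).
  exists (`|k| * C) => [|v]; first by rewrite mulr_ge0.
  by rewrite normrZ -mulrA ler_wpM2l.
Qed.

HB.instance Definition _ n := GRing.isSubmodClosed.Build K (('I_n -> D) -> Y)
  (@bmlin_pred n) (@bmlin_subsemimod_closed n).

Record bmlin n := Bmlin {
  bmlin_fun :> ('I_n -> D) -> Y;
  bmlin_funP : bmlin_pred bmlin_fun
}.

HB.instance Definition _ n := [isSub for @bmlin_fun n].
HB.instance Definition _ n := [Choice of bmlin n by <:].
HB.instance Definition _ n := [SubChoice_isSubLmodule of bmlin n by <:].

(* The tuple (a_1, .., a_k a_{k+1}, .., a_{n+1}), with indices from 0:
   [lift (lift ord0 k)] skips the index k + 1. *)
Definition merge_at n (k : 'I_n) (a : 'I_n.+1 -> D) : 'I_n -> D :=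
  fun j => if j == k then bmul (a (widen_ord (leqnSn n) k)) (a (lift ord0 k))
           else a (lift (lift ord0 k) j).

(* The k-th summand carries the sign (-1)^(k+1) since k starts from 0. *)
Definition hdiff_fun n (f : ('I_n -> D) -> Y) (a : 'I_n.+1 -> D) : Y :=
  lact (a ord0) (f (fun j => a (lift ord0 j)))
  + \sum_(k < n) (-1) ^+ k.+1 *: f (merge_at k a)
  + (-1) ^+ n.+1 *: ract (f (fun j => a (widen_ord (leqnSn n) j))) (a ord_max).

Lemma merge_at_self n (k : 'I_n) (a : 'I_n.+1 -> D) :
  merge_at k a k = bmul (a (widen_ord (leqnSn n) k)) (a (lift ord0 k)).
Proof. by rewrite /merge_at eqxx. Qed.

Lemma lift_lift_widen n (k : 'I_n) :
  lift (lift ord0 k) k = widen_ord (leqnSn n) k.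
Proof. by apply: val_inj; rewrite /= /bump leq0n add1n ltnn. Qed.

Lemma merge_at_dfwith n (k : 'I_n) (v : 'I_n.+1 -> D) i :
  exists j, exists2 L : D -> D, linear L & forall x,
    merge_at k (dfwith v (i := i) x) = dfwith (merge_at k v) (i := j) (L x).
Proof.
have kP : lift ord0 k != widen_ord (leqnSn n) k.
  by rewrite -lift_lift_widen neq_lift.
case: (unliftP (lift ord0 k) i) => [j ->|->]; last first.
  exists k, (bmul (v (widen_ord (leqnSn n) k))); first exact: bmul_linearr.
  move=> x; apply/funext => l; rewrite /merge_at.
  have [->|lk] := eqVneq l k; first by rewrite !dfwith_in dfwith_out.
  have kl : k != l by rewrite eq_sym.
  rewrite (dfwith_out _ _ kl) dfwith_out ?neq_lift//.
  by rewrite (negPf lk).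
have [->|jk] := eqVneq j k.
  exists k, (bmul^~ (v (lift ord0 k))); first exact: bmul_linearl.
  move=> x; apply/funext => l; rewrite /merge_at.
  have [->|lk] := eqVneq l k.
    by rewrite dfwith_in -lift_lift_widen dfwith_in dfwith_out// eq_sym neq_lift.
  have kl : k != l by rewrite eq_sym.
  rewrite (dfwith_out _ _ kl) dfwith_out ?(inj_eq lift_inj)//.
  by rewrite (negPf lk).
exists j, id => // x; apply/funext => l; rewrite /merge_at.
have [->|lk] := eqVneq l k.
  rewrite (dfwith_out _ _ jk) eqxx -lift_lift_widen !dfwith_out//.
    by rewrite eq_sym neq_lift.
  by rewrite (inj_eq lift_inj).
have [->|lj] := eqVneq l j.
  by rewrite !dfwith_in.
have jl : j != l by rewrite eq_sym.
rewrite (dfwith_out _ _ jl) dfwith_out ?(inj_eq lift_inj)//.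
by rewrite (negPf lk).
Qed.

Lemma multilinear_merge_at n (f : ('I_n -> D) -> Y) k :
  multilinear f -> multilinear (fun a => f (merge_at k a)).
Proof.
move=> fl v i c x y; have [j [L Ll mL]] := merge_at_dfwith k v i.
by rewrite !mL Ll fl.
Qed.

Lemma prod_merge_at n (k : 'I_n) (v : 'I_n.+1 -> D) :
  \prod_(j < n) `|merge_at k v j| <= \prod_(i < n.+1) `|v i|.
Proof.
rewrite (bigD1_ord (lift ord0 k))//= (bigD1 k)//= [X in _ <= _ * X](bigD1 k)//=.
rewrite mulrA merge_at_self lift_lift_widen ler_pM ?prodr_ge0//.
  by rewrite mulrC ler_norm_bmul.
by rewrite le_eqVlt; apply/orP; left; apply/eqP/eq_bigr => j /negPf jk;
  rewrite /merge_at jk.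
Qed.

Fact hdiff_subproof n (f : bmlin n) : bmlin_pred (hdiff_fun f).
Proof.
have /asboolP[fl [C C0 fC]] := bmlin_funP f.
apply/asboolP; split.
  move=> v i c x y; rewrite /hdiff_fun.
  rewrite !scalerDr addrACA [X in _ = X + _]addrACA; congr (_ + _ + _).
  - case: (unliftP ord0 i) => [j|] ->.
      have E z : (fun l => dfwith v (i := lift ord0 j) z (lift ord0 l)) =
          dfwith (fun l => v (lift ord0 l)) (i := j) z.
        apply/funext => l; have [->|lj] := eqVneq l j; first by rewrite !dfwith_in.
        by rewrite !dfwith_out// 1?eq_sym// (inj_eq lift_inj).
      by rewrite !E fl !dfwith_out 1?eq_sym ?neq_lift// lact_linearr.
    have E z : (fun l => dfwith v (i := ord0) z (lift ord0 l)) =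
        (fun l => v (lift ord0 l)).
      by apply/funext => l; rewrite dfwith_out// neq_lift.
    by rewrite !E !dfwith_in lact_linearl.
  - rewrite scaler_sumr -big_split /=; apply: eq_bigr => k _.
    rewrite (multilinear_merge_at k fl) scalerDr !scalerA.
    by rewrite (mulrC c).
  - have wE (l : 'I_n) : widen_ord (leqnSn n) l = lift ord_max l.
      by apply: val_inj; rewrite /= /bump leqNgt ltn_ord.
    case: (unliftP ord_max i) => [j|] ->.
      have E z : (fun l => dfwith v (i := lift ord_max j) z (widen_ord (leqnSn n) l)) =
          dfwith (fun l => v (widen_ord (leqnSn n) l)) (i := j) z.
        apply/funext => l; have [->|lj] := eqVneq l j.
          by rewrite wE !dfwith_in.
        by rewrite wE !dfwith_out -?wE// 1?eq_sym// ?wE (inj_eq lift_inj).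
      rewrite !E fl !dfwith_out 1?eq_sym ?neq_lift// ract_linearl.
      by rewrite scalerDr !scalerA (mulrC c).
    have E z : (fun l => dfwith v (i := ord_max) z (widen_ord (leqnSn n) l)) =
        (fun l => v (widen_ord (leqnSn n) l)).
      by apply/funext => l; rewrite wE dfwith_out// neq_lift.
    by rewrite !E !dfwith_in ract_linearr scalerDr !scalerA (mulrC c).
exists (C + \sum_(k < n) C + C) => [|v].
  by rewrite !addr_ge0// sumr_ge0.
have normsign m (z : Y) : `|(-1) ^+ m *: z| = `|z|.
  by rewrite normrZ normrX normrN1 expr1n mul1r.
rewrite !mulrDl mulr_suml /hdiff_fun.
rewrite (le_trans (ler_normD _ _))// lerD//.
  rewrite (le_trans (ler_normD _ _))// lerD//.
    rewrite (le_trans (ler_norm_lact _ _))// big_ord_recl mulrCA.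
    by rewrite ler_wpM2l.
  rewrite (le_trans (ler_norm_sum _ _ _))// ler_sum// => k _.
  rewrite normsign (le_trans (fC _))//.
  by rewrite ler_wpM2l// prod_merge_at.
rewrite normsign (le_trans (ler_norm_ract _ _))// big_ord_recr /= mulrA.
by rewrite ler_wpM2r.
Qed.

Definition hdiff n (f : bmlin n) : bmlin n.+1 := Bmlin (hdiff_subproof f).

Definition hdiff0_fun (y : Y) (a : 'I_1 -> D) : Y :=
  lact (a ord0) y - ract y (a ord0).

Fact hdiff0_subproof (y : Y) : bmlin_pred (hdiff0_fun y).
Proof.
apply/asboolP; split.
  move=> v i k x x'; rewrite (ord1 i) /hdiff0_fun !dfwith_in.
  by rewrite lact_linearl ract_linearr scalerBr opprD addrACA.
exists (`|y| + `|y|) => [|v]; first by rewrite addr_ge0.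
rewrite big_ord1 /hdiff0_fun.
rewrite (le_trans (ler_normB _ _))// mulrDl lerD ?ler_norm_ract//.
by rewrite mulrC ler_norm_lact.
Qed.

Definition hdiff0 (y : Y) : bmlin 1 := Bmlin (hdiff0_subproof y).

Definition cochain n : lmodType K := if n is m.+1 then bmlin m.+1 else Y.

Definition coboundary n : cochain n -> cochain n.+1 :=
  if n is m.+1 then @hdiff m.+1 else hdiff0.

Fact coboundary_linear n : linear (@coboundary n).
Proof.
case: n => [|n] k x y; apply: val_inj; apply/funext => a /=.
  rewrite addrfctE scalrfctE /hdiff0_fun lact_linearr ract_linearl.
  by rewrite scalerBr opprD addrACA.
rewrite addrfctE scalrfctE /hdiff_fun /= !addrfctE !scalrfctE.
rewrite lact_linearr ract_linearl.
rewrite !scalerDr [RHS]addrACA [X in _ = X + _]addrACA; congr (_ + _ + _).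
  rewrite scaler_sumr -big_split /=; apply: eq_bigr => i _.
  by rewrite scalerDr !scalerA (mulrC k).
by rewrite !scalerA (mulrC k).
Qed.

HB.instance Definition _ n := GRing.isLinear.Build K (cochain n)
  (cochain n.+1) _ (@coboundary n) (@coboundary_linear n).

Definition cocycle_pred n : pred (cochain n) := fun f => coboundary f == 0.

Fact cocycle_subsemimod_closed n : GRing.subsemimod_closed (@cocycle_pred n).
Proof.
split; [split|]; first by rewrite /cocycle_pred /in_mem /= linear0.
  by move=> f g /eqP f0 /eqP g0; apply/eqP; rewrite linearD /= f0 g0 addr0.
by move=> k f /eqP f0; apply/eqP; rewrite linearZ /= f0 scaler0.
Qed.

HB.instance Definition _ n := GRing.isSubmodClosed.Build K (cochain n)
  (@cocycle_pred n) (@cocycle_subsemimod_closed n).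

Record cocycle n :=
  Cocycle { cocycle_val :> cochain n; cocycle_valP : cocycle_pred cocycle_val }.

HB.instance Definition _ n := [isSub for @cocycle_val n].
HB.instance Definition _ n := [Choice of cocycle n by <:].
HB.instance Definition _ n := [SubChoice_isSubLmodule of cocycle n by <:].

Definition is_coboundary n : cochain n -> Prop :=
  if n is m.+1 then fun f : cochain m.+1 => exists g : cochain m, f = coboundary g
  else fun f => f = 0.

Definition coboundary_pred n : pred (cocycle n) :=
  fun f => `[< is_coboundary (val f) >].

Fact coboundary_subsemimod_closed n :
  GRing.subsemimod_closed (@coboundary_pred n).
Proof.
split; [split|]; case: n => [|n].
- exact/asboolP.
- apply/asboolP; exists 0; symmetry; exact: (linear0 (@coboundary n)).
- move=> f g /asboolP f0 /asboolP g0; apply/asboolP.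
  by change (val f + val g = 0); rewrite f0 g0 addr0.
- move=> f g /asboolP[f' ff'] /asboolP[g' gg']; apply/asboolP.
  exists (f' + g'); transitivity (coboundary f' + coboundary g').
    by rewrite -ff' -gg'.
  exact/esym/(linearD (@coboundary n)).
- move=> k f /asboolP f0; apply/asboolP.
  by change (k *: val f = 0); rewrite f0 scaler0.
- move=> k f /asboolP[f' ff']; apply/asboolP.
  exists (k *: f'); transitivity (k *: coboundary f'); first by rewrite -ff'.
  exact/esym/(linearZZ (@coboundary n)).
Qed.

End Cochains.


(* Linear quotient spaces: the library's [Quotient.quot] is only a Z-module. *)
Section QuotientSpace.
Variables (K : pzRingType) (V : lmodType K) (S : pred V).
Variable S_closed : GRing.subsemimod_closed S.
Local Open Scope quotient_scope.

Definition submod_pred of GRing.subsemimod_closed S : pred V := S.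

HB.instance Definition _ := GRing.isSubmodClosed.Build K V
  (submod_pred S_closed) S_closed.

Definition submod_zmod : zmodClosed V :=
  Algebra.ZmodClosed.clone V (submod_pred S_closed) _.

Definition quot_space := Quotient.quot submod_zmod.
HB.instance Definition _ := GRing.Zmodule.on quot_space.

Local Notation pi := (\pi_(Quotient.quot submod_zmod)).

Definition quot_scale (k : K) (u : quot_space) : quot_space :=
  pi (k *: repr (u : Quotient.quot submod_zmod)).

Lemma pi_scale (k : K) (v : V) : quot_scale k (pi v) = pi (k *: v).
Proof.
apply/eqP; rewrite -Quotient.idealrBE -scalerBr.
apply: (S_closed.2 k); change (repr (pi v) - v \in submod_zmod).
by rewrite Quotient.idealrBE reprK.
Qed.

Let piP (u : quot_space) : exists v, u = pi v.
Proof. by exists (repr (u : Quotient.quot submod_zmod)); rewrite reprK. Qed.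

Let piD (v w : V) : pi v + pi w = pi (v + w).
Proof. by rewrite [RHS]raddfD. Qed.

Fact quot_scaleA a b u : quot_scale a (quot_scale b u) = quot_scale (a * b) u.
Proof. by have [v ->] := piP u; rewrite !pi_scale scalerA. Qed.
Fact quot_scale1 : left_id 1 quot_scale.
Proof. by move=> u; have [v ->] := piP u; rewrite pi_scale scale1r. Qed.
Fact quot_scaleDr : right_distributive quot_scale +%R.
Proof.
move=> k u w; have [x ->] := piP u; have [y ->] := piP w.
by rewrite !pi_scale [in LHS]piD pi_scale scalerDr -piD.
Qed.
Fact quot_scaleDl u : {morph quot_scale^~ u : a b / a + b}.
Proof.
by move=> a b; have [x ->] := piP u; rewrite !pi_scale scalerDl -piD.
Qed.

HB.instance Definition _ := GRing.Zmodule_isLmodule.Build K quot_space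
  quot_scaleA quot_scale1 quot_scaleDr quot_scaleDl.

End QuotientSpace.

Definition cohomology (K : numFieldType) n (D : banachAlgType K)
  (Y : banachBimodType D D) : lmodType K := 
  quot_space (@coboundary_subsemimod_closed K D Y n).

Definition lin_iso (K : pzRingType) (U V : lmodType K) :=
  exists f : {linear U -> V}, bijective f.

(* Main.v *)
(* The bar complex carries the projection P that inserts e_A + e_B between any
   two consecutive letters, and P is chain homotopic to the identity. For the
   triangular algebra e_B T e_A = 0, so a word surviving P has all its letters in
   A, all its letters in B, or starts in e_A and ends in e_B; a cochain takes
   values in e_A X e_B = 0 on words of the last kind. Hence every cocycle on T is,
   up to a coboundary, the sum of the inflations of its restrictions to the two
   corners, while restriction undoes inflation. *)
Require Import Defs.
From HB Require Import structures.
From mathcomp Require Import all_boot all_order all_algebra.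
From mathcomp Require Import boolp classical_sets functions topology normedtype.
From mathcomp Require Import ssrAC zify.

Set Implicit Arguments.
Unset Strict Implicit.
Unset Printing Implicit Defensive.

Import Order.TTheory GRing.Theory Num.Theory.
Import numFieldNormedType.Exports.

Local Open Scope classical_set_scope.
Local Open Scope ring_scope.

(** * Linearity of bare functions *)

Section LinearPredicate.
Variables (K : pzRingType) (U V : lmodType K) (f : U -> V).
Hypothesis f_linear : linear f.

Let g : {linear U -> V} :=
  HB.pack f (GRing.isLinear.Build K U V _ f f_linear).

Lemma linear_pred0 : f 0 = 0. Proof. exact: (linear0 g). Qed.

Lemma linear_predB x y : f (x - y) = f x - f y.
Proof. exact: (linearB g). Qed.

Lemma linear_pred_sum (I : Type) (r : seq I) (F : I -> U) :
  f (\sum_(i <- r) F i) = \sum_(i <- r) f (F i).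
Proof. exact: (linear_sum g). Qed.

End LinearPredicate.

(** * The two-sided bar complex and its homotopy, on functions of words *)

Section BarComplex.
Variables (K : numFieldType) (D : banachAlgType K) (V : lmodType K).
Implicit Types (F G : D -> seq D -> V) (t x y : D) (l : seq D) (es : seq D).

(* A cochain is encoded as a function [F t l] of the nonempty word [t :: l]. *)
Definition freeze F t : D -> seq D -> V := fun x l => F t (x :: l).

(** Dual of the bar differential: the alternating sum of [F] over all merges of two adjacent
    letters. The outer letters will carry the bimodule actions, so no separate boundary terms
    occur. *)
Fixpoint bar_diff F t l : V :=
  if l is x :: l' then F (bmul t x) l' - bar_diff (freeze F t) x l' else 0.

(** On a word [t x_1 .. x_m] this is the sum of [F (t e_1, e_1 x_1 e_2, .., e_m x_m)] over all
    choices of the [e_i] in [es]. *)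
Fixpoint bar_proj es F t l : V :=
  if l is x :: l' then
    \sum_(e <- es) bar_proj es (freeze F (bmul t e)) (bmul e x) l'
  else F t [::].

(** Alternating sum in which idempotents fill an initial stretch of the gaps as in [bar_proj],
    except that the last one multiplies only its left neighbour and then stands as a letter of its
    own; the rest of the word is unchanged. *)
Fixpoint bar_homotopy es F t l : V :=
  if l is x :: l' then
    \sum_(e <- es) (F (bmul t e) [:: e, x & l'] -
      bar_homotopy es (freeze F (bmul t e)) (bmul e x) l')
  else 0.

Definition word_linear F :=
  (forall l, linear (F^~ l)) /\
  (forall t l l', linear (fun x => F t (l ++ x :: l'))).

Lemma freeze_word_linear F t : word_linear F -> word_linear (freeze F t).
Proof.
by move=> [_ Fl]; split=> [l|x l l']; [exact: (Fl t [::])|exact: (Fl t (x :: l))].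
Qed.

Lemma freeze_linear F k x y : word_linear F ->
  freeze F (k *: x + y) = fun u l => k *: freeze F x u l + freeze F y u l.
Proof. by move=> [Fl _]; apply/funext => u; apply/funext => j; apply: Fl. Qed.

Lemma bar_homotopy_linear es F G k t l :
  bar_homotopy es (fun u j => k *: F u j + G u j) t l =
  k *: bar_homotopy es F t l + bar_homotopy es G t l.
Proof.
elim: l F G t => [|x l IHl] F G t /=; first by rewrite scaler0 addr0.
rewrite scaler_sumr -big_split; apply: eq_bigr => e _ /=.
by rewrite IHl opprD addrACA -scalerN -scalerDr.
Qed.

Lemma bar_homotopy0 es t l : bar_homotopy es (fun _ _ => 0) t l = 0.
Proof.
elim: l t => [|x l IHl] t //=; apply: big1 => e _.
by rewrite IHl subr0.
Qed.

Lemma bar_proj0 es t l : bar_proj es (fun _ _ => 0) t l = 0.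
Proof. by elim: l t => [|x l IHl] t //=; apply: big1 => e _; exact: IHl. Qed.

Lemma bar_diff_sum (I : Type) (r : seq I) (F : I -> D -> seq D -> V) t l :
  bar_diff (fun u j => \sum_(i <- r) F i u j) t l =
  \sum_(i <- r) bar_diff (F i) t l.
Proof.
elim: l F t => [|x l IHl] F t /=; first by rewrite big1.
by rewrite IHl -sumrB.
Qed.

Lemma bar_diffB F G t l :
  bar_diff (fun u j => F u j - G u j) t l = bar_diff F t l - bar_diff G t l.
Proof.
elim: l F G t => [|x l IHl] F G t /=; first by rewrite subr0.
by rewrite IHl !opprD addrACA.
Qed.

Lemma bar_homotopyB es F G t l :
  bar_homotopy es (fun u j => F u j - G u j) t l =
  bar_homotopy es F t l - bar_homotopy es G t l.
Proof.
elim: l F G t => [|x l IHl] F G t /=; first by rewrite subr0.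
by rewrite -sumrB; apply: eq_bigr => e _; rewrite IHl !opprD addrACA.
Qed.

Lemma bar_diff_bmull F c t l :
  bar_diff (fun u => F (bmul c u)) t l = bar_diff F (bmul c t) l.
Proof. by case: l => [|x l] //=; rewrite bmulA. Qed.

Lemma bar_homotopy_bmull es F c t l :
  bar_homotopy es (fun u => F (bmul c u)) t l = bar_homotopy es F (bmul c t) l.
Proof.
by case: l => [|x l] //=; apply: eq_bigr => e _; rewrite bmulA /freeze bmulA.
Qed.

Lemma bar_homotopy_linear_head es F l : word_linear F ->
  linear (bar_homotopy es F ^~ l).
Proof.
move=> Fl k x y; case: l => [|z l] /=; first by rewrite scaler0 addr0.
rewrite scaler_sumr -big_split; apply: eq_bigr => e _ /=.
rewrite bmul_linearl Fl.1 freeze_linear // bar_homotopy_linear.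
by rewrite scalerBr opprD addrACA.
Qed.

(** Used twice: to expand the unit as a sum of idempotents in the head of a homotopy term, and to
    see that [contract] is multilinear. *)
Lemma bar_homotopy_word_linear es F : word_linear F ->
  word_linear (bar_homotopy es F).
Proof.
move=> Fl; split=> [l|]; first exact: bar_homotopy_linear_head.
move=> t l; elim: l F t Fl => [|z l IHl] F t Fl l' k x y /=.
  rewrite scaler_sumr -big_split; apply: eq_bigr => e _ /=.
  rewrite (Fl.2 _ [:: e]) bmul_linearr.
  rewrite (bar_homotopy_linear_head _ _ (freeze_word_linear _ Fl)).
  by rewrite scalerBr opprD addrACA.
rewrite scaler_sumr -big_split; apply: eq_bigr => e _ /=.
rewrite (Fl.2 _ [:: e, z & l]) (IHl _ _ (freeze_word_linear _ Fl)).
by rewrite scalerBr opprD addrACA.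
Qed.

(** Induction on the word, with [F] general because the step freezes the head at [bmul t e].
    Idempotency absorbs repeated factors [e], and the sum being the unit inserts an [e] where it is
    missing. *)
Lemma bar_homotopyP es F t l :
    (forall e, e \in es -> bmul e e = e) -> \sum_(e <- es) e = bone ->
    word_linear F ->
  bar_diff (bar_homotopy es F) t l + bar_homotopy es (bar_diff F) t l =
  F t l - bar_proj es F t l.
Proof.
move=> ee e1; elim: l F t => [|x l IHl] F t Fl; first by rewrite /= addr0 subrr.
have sum_head G j : word_linear G ->
    \sum_(e <- es) G (bmul t e) j = G t j.
  move=> Gl; rewrite -[in RHS](bmul1r t) -e1.
  rewrite (linear_pred_sum (f := fun e => G (bmul t e) j)) //.
  by move=> k u v; rewrite bmul_linearr Gl.1.
have sum_mid G j : word_linear G ->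
    \sum_(e <- es) G (bmul t (bmul e x)) j = G (bmul t x) j.
  move=> Gl; rewrite -[in RHS](bmul1l x) -e1.
  rewrite (linear_pred_sum (f := fun e => G (bmul t (bmul e x)) j)) //.
  by move=> k u v; rewrite bmul_linearl bmul_linearr Gl.1.
have -> : bar_diff (bar_homotopy es F) t (x :: l) =
    bar_homotopy es F (bmul t x) l -
      (\sum_(e <- es) (bar_diff (freeze (freeze F (bmul t e)) e) x l
        - bar_diff (bar_homotopy es (freeze F (bmul t e))) (bmul e x) l)).
  rewrite /= /freeze /= bar_diff_sum; congr (_ - _); apply: eq_bigr => e _.
  by rewrite bar_diffB -(bar_diff_bmull (bar_homotopy es _)).
have -> : bar_homotopy es (bar_diff F) t (x :: l) =
    \sum_(e <- es) (F (bmul t e) (x :: l) - F (bmul t e) (bmul e x :: l)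
      + bar_diff (freeze (freeze F (bmul t e)) e) x l
      - (bar_homotopy es F (bmul t (bmul e x)) l
         - bar_homotopy es (bar_diff (freeze F (bmul t e))) (bmul e x) l)).
  rewrite /=; apply: eq_big_seq => e /ee eid.
  have -> : freeze (bar_diff F) (bmul t e) = fun u j =>
      F (bmul (bmul t e) u) j - bar_diff (freeze F (bmul t e)) u j by [].
  rewrite bar_homotopyB bar_homotopy_bmull -!bmulA (bmulA e e x) eid.
  by rewrite opprB addrA; congr (_ - _); rewrite addrAC.
(* Both sides become sums over [es], so the identity can be checked for each [e] separately. *)
rewrite -(sum_mid _ l (bar_homotopy_word_linear es Fl)).
rewrite -[in RHS](sum_head _ (x :: l) Fl) /=.
rewrite -!sumrB -big_split; apply: eq_bigr => e _ /=.
have := IHl (freeze F (bmul t e)) (bmul e x) (freeze_word_linear _ Fl).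
rewrite {3}/freeze.
move: (bar_homotopy _ F _ _) (bar_diff (freeze (freeze _ _) _) _ _).
move: (bar_diff _ _ _) (bar_homotopy _ _ _ _) (bar_proj _ _ _ _) (F _ _) (F _ _).
move=> dh hd p a v h d dhhd; rewrite -[p](subKr v) -dhhd !opprB !addrA.
by rewrite [LHS](ACl (4*2*7*5*(1*8)*(6*3))) /= !subrr !addr0.
Qed.

Lemma freeze_word_linear0 F : word_linear F -> freeze F 0 = fun _ _ => 0.
Proof.
by move=> [Fl _]; apply/funext => u; apply/funext => j;
  exact: linear_pred0 (Fl (u :: j)).
Qed.

Lemma bar_proj1_rcons F e t l u :
  bar_proj [:: e] F t (rcons l u) =
  F (bmul t e) (rcons [seq bmul (bmul e x) e | x <- l] (bmul e u)).
Proof.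
by elim: l F t => [|x l IHl] F t; rewrite /= big_seq1 // IHl.
Qed.

(** Inserting [e1] would make the head [e2 t e1 = 0]. Inserting [e2] makes the next head start with
    [e2] again, so the argument repeats. *)
Lemma bar_proj_lower (e1 e2 : D) F t l : (forall x, bmul (bmul e2 x) e1 = 0) ->
    word_linear F ->
  bar_proj [:: e1; e2] F (bmul e2 t) l = bar_proj [:: e2] F (bmul e2 t) l.
Proof.
move=> e21; elim: l F t => [|x l IHl] F t Fl //=.
rewrite big_cons !big_seq1 e21 freeze_word_linear0 // bar_proj0 add0r.
exact/IHl/freeze_word_linear.
Qed.

(** Once [e2] is inserted, [bar_proj_lower] forces [e2] into all later gaps; the last letter then
    lies in [e2 D], where [F] vanishes. *)
Lemma bar_proj_upper (e1 e2 : D) F t l : (forall x, bmul (bmul e2 x) e1 = 0) ->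
    word_linear F -> (forall t l u, F t (rcons l (bmul e2 u)) = 0) ->
  bar_proj [:: e1; e2] F t l = bar_proj [:: e1] F t l.
Proof.
move=> e21; elim: l F t => [|x l IHl] F t Fl F0 //=.
rewrite big_cons !big_seq1 IHl ?(bar_proj_lower _ _ e21) //.
- rewrite -[RHS]addr0; congr (_ + _); case/lastP: l {IHl} => [|l u].
    exact: (F0 _ [::]).
  by rewrite bar_proj1_rcons /freeze -rcons_cons F0.
- exact: freeze_word_linear.
- exact: freeze_word_linear.
- by move=> s l' u; rewrite /freeze -rcons_cons F0.
Qed.

Lemma bar_homotopy_eq0 es F t l :
    (forall u j, size j = (size l).+1 -> F u j = 0) ->
  bar_homotopy es F t l = 0.
Proof.
elim: l F t => [|x l IHl] F t F0 //=; apply: big1 => e _.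
by rewrite F0 // IHl ?subr0 // => u j sj; apply: F0; rewrite /= sj.
Qed.

Lemma bar_homotopy_comp es F (h : V -> V) t l : linear h ->
  bar_homotopy es (fun u j => h (F u j)) t l = h (bar_homotopy es F t l).
Proof.
move=> hl; elim: l F t => [|x l IHl] F t /=; first by rewrite linear_pred0.
rewrite (linear_pred_sum hl); apply: eq_bigr => e _ /=.
by rewrite (linear_predB hl) -IHl.
Qed.

(** Here and in [bar_homotopy_homogr]: the homotopy multiplies the outer letters only on their inner
    sides, so it commutes with the outer actions. *)
Lemma bar_homotopy_homogl es F (h : V -> V) c t l : linear h ->
    (forall u j, F (bmul c u) j = h (F u j)) ->
  bar_homotopy es F (bmul c t) l = h (bar_homotopy es F t l).
Proof.
move=> hl Fc; rewrite -bar_homotopy_comp // -bar_homotopy_bmull.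
by congr bar_homotopy; apply/funext => u; apply/funext => j.
Qed.

Lemma bar_homotopy_homogr es F (h : V -> V) c t l u : linear h ->
    (forall t l u, F t (rcons l (bmul u c)) = h (F t (rcons l u))) ->
  bar_homotopy es F t (rcons l (bmul u c)) = h (bar_homotopy es F t (rcons l u)).
Proof.
move=> hl; elim: l F t => [|x l IHl] F t Fc /=;
  rewrite (linear_pred_sum hl); apply: eq_bigr => e _;
  rewrite (linear_predB hl) /=.
  by rewrite (Fc _ [:: e]) (linear_pred0 hl) /=.
rewrite (Fc _ [:: e, x & l]) IHl // => s j v.
by rewrite /freeze -rcons_cons Fc.
Qed.

End BarComplex.

(** The constant must be uniform in [F]: the induction applies the bound to [freeze F (bmul t e)],
    whose own constant is [C] times the norm of [bmul t e]. *)
Lemma bar_homotopy_bounded (K : numFieldType) (D : banachAlgType K)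
    (V : normedModType K) (es : seq D) m :
  exists2 c : K, 0 <= c & forall (F : D -> seq D -> V) (C : K), 0 <= C ->
    (forall t l, `|F t l| <= C * (`|t| * \prod_(x <- l) `|x|)) ->
    forall t l, size l = m ->
      `|bar_homotopy es F t l| <= c * C * (`|t| * \prod_(x <- l) `|x|).
Proof.
pose E : K := \sum_(e <- es) `|e| * `|e|.
have E0 : 0 <= E by apply: sumr_ge0 => e _; rewrite mulr_ge0.
elim: m => [|m [c c0 IHm]].
  exists 0 => // F C C0 FC t [|x l] //= _.
  by rewrite normr0 !mul0r.
(* Each [e] occurs twice in a term, hence the squared norms in [E]; the summands bound the term with
   the inserted letter and the recursive term. *)
exists (E + c * E) => [|F C C0 FC t [|x l] //= [lm]].
  by rewrite addr_ge0 // mulr_ge0.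
have P0 (j : seq D) : 0 <= \prod_(x <- j) `|x| by apply: prodr_ge0.
apply: le_trans (ler_norm_sum _ _ _) _.
rewrite mulrDl mulrDl mulr_sumr !mulr_suml -big_split; apply: ler_sum => e _ /=.
apply: le_trans (ler_normB _ _) _; apply: lerD.
  apply: le_trans (FC _ _) _; rewrite !big_cons.
  rewrite !mulrA [leRHS](ACl (3*(4*1)*2*5*6)) /=.
  do 3![apply: ler_wpM2r => //].
  by apply: ler_wpM2l => //; exact: ler_norm_bmul.
have FtC (u : D) j : `|freeze F (bmul t e) u j| <=
    C * `|bmul t e| * (`|u| * \prod_(x <- j) `|x|).
  by apply: le_trans (FC _ _) _; rewrite big_cons [leLHS]mulrA.
apply: le_trans (IHm _ _ _ FtC _ _ lm) _; first by rewrite mulr_ge0.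
rewrite big_cons !mulrA [leRHS](ACl (1*4*(5*2)*(3*6)*7)) /=.
apply: ler_wpM2r => //; apply: ler_pM; rewrite ?mulr_ge0 ?ler_norm_bmul //.
by rewrite ler_wpM2l ?mulr_ge0 ?ler_norm_bmul.
Qed.

(** * Hochschild cochains as functions on words *)

Section Augmentation.
Variables (K : numFieldType) (D : banachAlgType K) (Y : banachBimodType D D).
Implicit Types (t u x : D) (l : seq D) (y : Y).

(* The value of the bimodule extension of [f] on the bar complex, set to 0 on
   words of the wrong length. *)
Definition augment n (f : ('I_n -> D) -> Y) t l : Y :=
  if size l == n.+1 then ract (lact t (f (fun j => nth 0 l j))) (nth 0 l n)
  else 0.

Definition merge_word k l : seq D :=
  take k l ++ bmul (nth 0 l k) (nth 0 l k.+1) :: drop k.+2 l.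

Lemma size_merge_word k l : (k.+1 < size l)%N ->
  size (merge_word k l) = (size l).-1.
Proof.
move=> kl; rewrite /merge_word size_cat /= size_takel ?size_drop;
  last exact/ltnW/ltnW.
by lia.
Qed.

Lemma nth_merge_word k l j : (k.+1 < size l)%N ->
  nth 0 (merge_word k l) j =
  if j == k then bmul (nth 0 l k) (nth 0 l k.+1) else nth 0 l (bump k.+1 j).
Proof.
move=> kl; rewrite /merge_word nth_cat size_takel /bump; last exact/ltnW/ltnW.
case: ltngtP => [jk|kj|->]; last by rewrite subnn.
  by rewrite nth_take.
case: j kj => [//|j]; rewrite ltnS => kj.
by rewrite subSn //= nth_drop addSn addSn subnKC.
Qed.

Lemma bar_diff_cons (V : lmodType K) (F : D -> seq D -> V) t x l :
  bar_diff F t (x :: l) = F (bmul t x) l -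
    \sum_(k < size l) (-1) ^+ k *: F t (merge_word k (x :: l)).
Proof.
elim: l F t x => [|y l IHl] F t x; first by rewrite big_ord0.
rewrite /= -/(bar_diff (freeze F t) x (y :: l)) IHl big_ord_recl; congr (_ - _).
rewrite expr0 scale1r /merge_word /= drop0 -sumrN; congr (_ + _).
by apply: eq_bigr => k _; rewrite exprS mulN1r scaleNr.
Qed.

Lemma bimod_linear t u : linear (fun y => ract (lact t y) u).
Proof. by move=> k y y'; rewrite lact_linearr ract_linearl. Qed.

Lemma augment_rcons n (f : ('I_n -> D) -> Y) t l u : size l = n ->
  augment f t (rcons l u) = ract (lact t (f (fun j => nth 0 l j))) u.
Proof.
move=> ln; rewrite /augment size_rcons ln eqxx nth_rcons ln ltnn eqxx.
by congr (ract (lact t (f _)) u); apply/funext => j; rewrite nth_rcons ln ltn_ord.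
Qed.

(** Merging into the head gives the left action, merging the last two letters gives the right
    action, and the inner merges are those of [merge_at]. *)
Lemma bar_diff_augment n (f : ('I_n -> D) -> Y) t l :
  bar_diff (augment f) t l = augment (hdiff_fun f) t l.
Proof.
case: l => [//|x l]; rewrite bar_diff_cons [RHS]/augment /= eqSS.
have [ln|ln] := eqVneq; last first.
  rewrite /augment (negPf ln) sub0r big1 ?oppr0 // => k _.
  by rewrite size_merge_word //= ?ltnS // (negPf ln) scaler0.
set u := nth 0 l n.
have LS (G : 'I_n -> Y) : ract (lact t (\sum_(k < n) G k)) u =
    \sum_(k < n) ract (lact t (G k)) u := linear_pred_sum (bimod_linear t u) _ _.
have LZ k y : ract (lact t (k *: y)) u = k *: ract (lact t y) u.
  by rewrite lactZr ractZl.
(* [big_ord_recr] splits off the merge with the last letter [u]. *)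
rewrite ln big_ord_recr /= /hdiff_fun !lactDr !ractDl LS LZ opprD addrA.
congr (_ + _ + _).
- by rewrite /augment ln eqxx lactM.
- rewrite -sumrN; apply: eq_bigr => k _; rewrite LZ exprS mulN1r scaleNr.
  have kl : (k.+1 < size (x :: l))%N by rewrite /= ln !ltnS ltnW.
  rewrite /augment size_merge_word //= ln eqxx nth_merge_word //.
  rewrite gtn_eqF // /bump ltn_ord; congr (- (_ *: ract (lact t (f _)) _)).
  by apply/funext => j; rewrite nth_merge_word.
- rewrite exprS mulN1r scaleNr; congr (- (_ *: _)).
  have nl : (n.+1 < size (x :: l))%N by rewrite /= ln.
  rewrite /augment size_merge_word //= ln eqxx nth_merge_word // eqxx ractM.
  rewrite lactA; congr (ract (ract (lact t (f _)) _) _).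
  apply/funext => j; rewrite nth_merge_word // ltn_eqF //.
  by rewrite /bump ltnNge ltnW.
Qed.

End Augmentation.

(** * The homotopy on Hochschild cochains *)

Section Contraction.
Variables (K : numFieldType) (D : banachAlgType K) (Y : banachBimodType D D).
Implicit Types (t u x : D) (l : seq D) (y : Y) (es : seq D).

Lemma augment_word_linear n (f : ('I_n -> D) -> Y) :
  multilinear f -> word_linear (augment f).
Proof.
move=> fl; split=> [l|t l l'] k x y; rewrite /augment ?size_cat /=.
  case: ifP => _; last by rewrite scaler0 addr0.
  by rewrite lact_linearl ract_linearl.
case: ifP => [/eqP sl|_]; last by rewrite scaler0 addr0.
have [ln|ln] := eqVneq (size l) n.
  have nE z : (fun j : 'I_n => nth 0 (l ++ z :: l') j) = (fun j => nth 0 l j).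
    by apply/funext => j; rewrite nth_cat ln ltn_ord.
  by rewrite !nE !nth_cat ln ltnn subnn /= ract_linearr.
have {}ln : (size l < n)%N by lia.
(* The varied letter is now an argument of [f]; the [0] put there in the witness is overwritten by
   [dfwith]. *)
have [v vE] : exists v, forall z, (fun j : 'I_n => nth 0 (l ++ z :: l') j) =
    dfwith v (i := Ordinal ln) z.
  exists (fun j : 'I_n => nth 0 (l ++ 0 :: l') j) => z.
  apply/funext => j; have [->|jl] := eqVneq j (Ordinal ln).
    by rewrite dfwith_in /= nth_cat ltnn subnn.
  rewrite dfwith_out 1?eq_sym // !nth_cat; case: ltngtP => // [lj|lj].
    by case: (j - size l)%N (subn_gt0 (size l) j) => [|//]; rewrite lj.
  by move/eqP: jl => []; apply: val_inj.
have uE z : nth 0 (l ++ z :: l') n = nth 0 (l ++ x :: l') n.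
  rewrite !nth_cat ltnNge (ltnW ln) /=.
  by case: (n - _)%N (subn_gt0 (size l) n) => [|//]; rewrite ln.
by rewrite !vE (uE (_ + _)) (uE y) fl lact_linearr ract_linearl.
Qed.

Lemma augment_bounded n (f : ('I_n -> D) -> Y) : bounded_multi f ->
  exists2 C : K, 0 <= C &
    forall t l, `|augment f t l| <= C * (`|t| * \prod_(x <- l) `|x|).
Proof.
case=> C C0 fC; exists C => // t l.
have P0 (j : seq D) : 0 <= \prod_(x <- j) `|x| by apply: prodr_ge0.
have [ln|ln] := eqVneq (size l) n.+1; last first.
  by rewrite /augment (negPf ln) normr0 !mulr_ge0.
case/lastP: l ln => [//|l u]; rewrite size_rcons => -[ln].
rewrite augment_rcons // big_rcons /= (big_nth 0) big_mkord ln.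
apply: le_trans (ler_norm_ract _ _) _; rewrite !mulrA ler_wpM2r //.
apply: le_trans (ler_norm_lact _ _) _; rewrite (mulrC C) -mulrA.
exact: ler_wpM2l (fC _).
Qed.

(** A bimodule map on words is determined by those whose outer letters are the unit; the cochain is
    read off there. *)
Definition contract es n (f : ('I_n.+1 -> D) -> Y) : ('I_n -> D) -> Y :=
  fun v => bar_homotopy es (augment f) bone
    (rcons [seq v i | i <- enum 'I_n] bone).

Lemma bar_homotopy_augment es n (f : ('I_n.+1 -> D) -> Y) t l :
  bar_homotopy es (augment f) t l = augment (contract es f) t l.
Proof.
have [ln|ln] := eqVneq (size l) n.+1; last first.
  rewrite [RHS]/augment (negPf ln) bar_homotopy_eq0 // => u j jl.
  by rewrite /augment jl eqSS (negPf ln).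
case/lastP: l ln => [//|l u]; rewrite size_rcons => -[ln].
(* With [t] and [u] written as multiples of the unit, equivariance pulls them out and leaves the
   definition of [contract]. *)
rewrite augment_rcons // -{1}(bmul1r t) -{1}(bmul1l u).
rewrite (bar_homotopy_homogr _ (h := fun y => ract y u)).
- rewrite (bar_homotopy_homogl _ (h := lact t)).
  + congr (ract (lact t (bar_homotopy _ _ _ (rcons _ _))) u).
    apply: (@eq_from_nth _ 0) => [|i il].
      by rewrite size_map size_enum_ord.
    have iN : (i < n)%N by rewrite -ln.
    by rewrite (nth_map (Ordinal iN)) ?size_enum_ord // nth_enum_ord.
  + exact: lact_linearr.
  + by move=> s j; rewrite /augment; case: ifP => _;
      rewrite ?lact0r // lactM lactA.
- exact: ract_linearl.
- move=> s j w; rewrite /augment !size_rcons.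
  case: eqP => [[js]|_]; last by rewrite ract0l.
  rewrite !nth_rcons js ltnn eqxx ractM; congr (ract (ract (lact s (f _)) _) _).
  by apply/funext => i; rewrite !nth_rcons js ltn_ord.
Qed.

Lemma contract_bmlin es n (f : bmlin Y n.+1) : bmlin_pred (contract es f).
Proof.
have /asboolP[fl fb] := bmlin_funP f; apply/asboolP; split.
  have [_ Fl] := bar_homotopy_word_linear es (augment_word_linear fl).
  move=> v i k x y; rewrite /contract.
  (* Splitting the enumeration at [i] gives the form required by [word_linear]. *)
  have [l1 [l2 lE]] : exists l1 l2, forall z,
      rcons [seq dfwith v (i := i) z j | j <- enum 'I_n] bone = l1 ++ z :: l2.
    have ie : i \in enum 'I_n by rewrite mem_enum.
    have := enum_uniq 'I_n; case/path.splitPr: _ / ie => p1 p2.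
    rewrite cat_uniq /= negb_or => /and3P[_ /andP[ip1 _] /andP[ip2 _]].
    exists [seq v j | j <- p1], (rcons [seq v j | j <- p2] bone) => z.
    have outE p : i \notin p ->
        [seq dfwith v (i := i) z j | j <- p] = [seq v j | j <- p].
      move=> ip; apply/eq_in_map => j jp; rewrite dfwith_out //.
      by apply: contraNneq ip => ->.
    by rewrite map_cat rcons_cat /= dfwith_in !outE.
  by rewrite !lE Fl.
have [C C0 FC] := augment_bounded fb.
have [c c0 hc] := bar_homotopy_bounded Y es n.+1.
(* The unit need not have norm 1, so both outer letters contribute. *)
exists (c * C * (`|bone : D| * `|bone : D|)) => [|v].
  by rewrite !mulr_ge0.
apply: le_trans (hc _ _ C0 FC _ _ _) _.
  by rewrite size_rcons size_map size_enum_ord.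
by rewrite big_rcons /= big_map big_enum /= -!mulrA (mulrC (\prod_(_ < n) _)).
Qed.

(** The first inserted idempotent decides: after [e2] only [e2] can follow, and after [e1] a switch
    to [e2] gives a value in [e1 Y e2 = 0]. *)
Lemma sum_bar_proj (e1 e2 : D) n (f : ('I_n -> D) -> Y) t l :
    (forall z, bmul (bmul e2 z) e1 = 0) ->
    (forall y, ract (lact e1 y) e2 = 0) -> multilinear f -> l != [::] ->
  bar_proj [:: e1; e2] (augment f) t l =
  bar_proj [:: e1] (augment f) t l + bar_proj [:: e2] (augment f) t l.
Proof.
move=> e21 e12 fl; case: l => [//|x l] _; rewrite /= big_cons !big_seq1.
have Fl z := freeze_word_linear z (augment_word_linear fl).
rewrite bar_proj_upper ?bar_proj_lower // => u j w.
rewrite /freeze -rcons_cons /augment; case: ifP => // /eqP sj.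
have -> : nth 0 (rcons (u :: j) (bmul e2 w)) n = bmul e2 w.
  by move: sj; rewrite size_rcons nth_rcons => -[<-]; rewrite ltnn eqxx.
by rewrite lactM ractM -lactA e12 lact0r ract0l.
Qed.

Lemma augment_enum n (f : ('I_n -> D) -> Y) (v : 'I_n -> D) t u :
  augment f t (rcons [seq v i | i <- enum 'I_n] u) = ract (lact t (f v)) u.
Proof.
rewrite augment_rcons; last by rewrite size_map size_enum_ord.
congr (ract (lact t (f _)) u); apply/funext => j.
by rewrite (nth_map j) ?size_enum_ord // nth_ord_enum.
Qed.

End Contraction.

(** This is [bar_homotopyP] on the word [1, v, 1]: the homotopy of the differential vanishes for a
    cocycle, and [sum_bar_proj] splits the projection into the two corner terms. *)
Lemma cocycle_peirce (K : numFieldType) (D : banachAlgType K)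
    (Y : unitalBanachBimodType D D) (e1 e2 : D) n (f : bmlin Y n.+1) :
    bmul e1 e1 = e1 -> bmul e2 e2 = e2 -> e1 + e2 = bone ->
    (forall z, bmul (bmul e2 z) e1 = 0) ->
    (forall y : Y, ract (lact e1 y) e2 = 0) ->
    hdiff f = 0 ->
  exists g : cochain Y n, forall v,
    f v = ract (lact e1 (f (fun j => bmul (bmul e1 (v j)) e1))) e1 +
          ract (lact e2 (f (fun j => bmul (bmul e2 (v j)) e2))) e2 +
          coboundary g v.
Proof.
move=> e11 e22 e1D2 e21 e12 f0; pose es := [:: e1; e2].
have /asboolP[fl _] := bmlin_funP f.
have [g gE] : exists g : cochain Y n, forall v,
    coboundary g v = hdiff_fun (contract es f) v.
  have := contract_bmlin es f; case: n f {fl} f0 => [|n] f f0 cP.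
    (* A cochain of degree 0 is an element of [Y]: the value of [contract] on the empty tuple, here
       represented by [fun=> 0]. *)
    exists (contract es f (fun=> 0)) => v.
    have cE w : contract es f w = contract es f (fun=> 0).
      by congr contract; apply/funext => -[].
    rewrite /hdiff_fun big_ord0 addr0 !cE /= /hdiff0_fun (ord1 ord_max).
    by rewrite expr1 scaleN1r.
  by exists (Bmlin cP).
exists g => v.
have ees e : e \in es -> bmul e e = e.
  by rewrite !inE => /orP[] /eqP ->.
have sum1 : \sum_(e <- es) e = bone by rewrite big_cons big_seq1.
have hE : bar_homotopy es (augment f) = augment (contract es f).
  by apply/funext => t; apply/funext => l; exact: bar_homotopy_augment.
have dE : bar_diff (augment f) = fun _ _ => 0.
  apply/funext => t; apply/funext => l; rewrite bar_diff_augment.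
  have -> : hdiff_fun f = fun=> 0 := congr1 val f0.
  by rewrite /augment lact0r ract0l if_same.
have := bar_homotopyP bone (rcons [seq v i | i <- enum 'I_n.+1] bone)
  ees sum1 (augment_word_linear fl).
rewrite hE dE bar_homotopy0 addr0 bar_diff_augment.
rewrite sum_bar_proj //; last by rewrite -size_eq0 size_rcons.
have mapE e : [seq bmul (bmul e x) e | x <- [seq v i | i <- enum 'I_n.+1]] =
    [seq bmul (bmul e (v i)) e | i <- enum 'I_n.+1] by rewrite -map_comp.
rewrite !bar_proj1_rcons !mapE !augment_enum !bmul1l !bmul1r !lact1 !ract1 gE.
by move=> ->; rewrite addrC subrK.
Qed.

(** * Isomorphisms from a quotient to a product of quotients *)

Section QuotientProduct.
Variables (K : pzRingType) (V W1 W2 : lmodType K).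
Variables (S : pred V) (S1 : pred W1) (S2 : pred W2).
Variables (Sc : GRing.subsemimod_closed S) (S1c : GRing.subsemimod_closed S1).
Variables (S2c : GRing.subsemimod_closed S2).
Variables (r1 : V -> W1) (r2 : V -> W2).
Local Open Scope quotient_scope.

Lemma eq_pi_quot (U : lmodType K) (P : pred U) (Pc : GRing.subsemimod_closed P)
    (u v : U) :
  \pi_(Quotient.quot (submod_zmod Pc)) u = \pi_(Quotient.quot (submod_zmod Pc)) v
  <-> P (u - v).
Proof.
split=> [uv|Puv].
  by change (u - v \in submod_zmod Pc); rewrite Quotient.idealrBE uv.
by apply/eqP; rewrite -Quotient.idealrBE.
Qed.

Lemma pi_quot_linear (U : lmodType K) (P : pred U)
    (Pc : GRing.subsemimod_closed P) :
  linear (\pi_(Quotient.quot (submod_zmod Pc)) : U -> quot_space Pc).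
Proof.
move=> k u v; have -> :
  k *: (\pi_(Quotient.quot (submod_zmod Pc)) u : quot_space Pc) =
  \pi_(Quotient.quot (submod_zmod Pc)) (k *: u) := pi_scale Pc k u.
exact: (raddfD (\pi_(Quotient.quot (submod_zmod Pc)))).
Qed.

(** A class goes to the classes of [r1] and [r2] of a representative. The forward half of the
    condition on [S] makes this well defined, the converse makes it injective. *)
Lemma quot_space_prod_iso : linear r1 -> linear r2 ->
    (forall v, S v <-> S1 (r1 v) /\ S2 (r2 v)) ->
    (forall w1 w2, exists v, r1 v = w1 /\ r2 v = w2) ->
  lin_iso (quot_space Sc) (quot_space S1c * quot_space S2c)%type.
Proof.
move=> l1 l2 SE rsurj.
pose p v : quot_space Sc := \pi_(Quotient.quot (submod_zmod Sc)) v.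
pose p1 v : quot_space S1c := \pi_(Quotient.quot (submod_zmod S1c)) v.
pose p2 v : quot_space S2c := \pi_(Quotient.quot (submod_zmod S2c)) v.
have pP (u : quot_space Sc) : exists v, u = p v.
  by exists (repr (u : Quotient.quot (submod_zmod Sc))); rewrite /p reprK.
have pl := pi_quot_linear Sc.
have p1l := pi_quot_linear S1c.
have p2l := pi_quot_linear S2c.
pose f (u : quot_space Sc) : (quot_space S1c * quot_space S2c)%type :=
  let v := repr (u : Quotient.quot (submod_zmod Sc)) in (p1 (r1 v), p2 (r2 v)).
have fE v : f (p v) = (p1 (r1 v), p2 (r2 v)).
  have /SE[] : S (repr (p v : Quotient.quot (submod_zmod Sc)) - v).
    by apply/eq_pi_quot; rewrite reprK.
  rewrite (linear_predB l1) (linear_predB l2) /f.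
  by move=> q1 q2; congr pair; apply/eq_pi_quot.
have fl : linear f.
  move=> k u w; have [x ->] := pP u; have [y ->] := pP w.
  by rewrite -pl !fE l1 l2 /p1 /p2 p1l p2l.
pose g : {linear quot_space Sc -> (quot_space S1c * quot_space S2c)%type} :=
  HB.pack f (GRing.isLinear.Build K _ _ _ f fl).
have f_inj : injective f.
  move=> u w; have [x ->] := pP u; have [y ->] := pP w; rewrite !fE => -[q1 q2].
  apply/eq_pi_quot/SE; rewrite (linear_predB l1) (linear_predB l2).
  by split; exact/(eq_pi_quot _ _ _).1.
have f_surj w : exists u, f u = w.
  case: w => w1 w2.
  have [v [v1 v2]] := rsurj (repr (w1 : Quotient.quot (submod_zmod S1c)))
    (repr (w2 : Quotient.quot (submod_zmod S2c))).
  by exists (p v); rewrite fE v1 v2 /p1 /p2 !reprK.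
have [h hK] := choice f_surj.
by exists g, h => // u; apply: f_inj; exact: hK.
Qed.
End QuotientProduct.

(* The data along which cochains are transported: arguments pull back along
   [psi], values push forward along the map. *)
Record bimodMap (K : numFieldType) (D1 D2 : banachAlgType K)
    (psi : banachHom D1 D2) (Y2 : banachBimodType D2 D2)
    (Y1 : banachBimodType D1 D1) := BimodMap {
  bimod_map :> Y2 -> Y1;
  bimod_map_linear : linear bimod_map;
  bimod_map_lact : forall d y, bimod_map (lact (psi d) y) = lact d (bimod_map y);
  bimod_map_ract : forall y d, bimod_map (ract y (psi d)) = ract (bimod_map y) d;
  bimod_map_bounded :
    exists2 c : K, 0 <= c & forall y, `|bimod_map y| <= c * `|y|
}.

(** * Functoriality of cochains and cocycles *)

Section CochainMap.
Variables (K : numFieldType) (D1 D2 : banachAlgType K).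
Variables (psi : banachHom D1 D2) (Y2 : banachBimodType D2 D2).
Variables (Y1 : banachBimodType D1 D1) (L : bimodMap psi Y2 Y1).

Definition transport n (f : ('I_n -> D2) -> Y2) (v : 'I_n -> D1) : Y1 :=
  L (f (fun i => psi (v i))).

Lemma transport_bmlin n (f : bmlin Y2 n) : bmlin_pred (transport f).
Proof.
have /asboolP[fl [C C0 fC]] := bmlin_funP f.
have [c c0 Lc] := bimod_map_bounded L.
apply/asboolP; split=> [v i k x y|].
  have psiE z : (fun j => psi (dfwith v (i := i) z j)) =
      dfwith (fun j => psi (v j)) (i := i) (psi z).
    apply/funext => j; have [->|ji] := eqVneq j i; first by rewrite !dfwith_in.
    by rewrite !dfwith_out // eq_sym.
  by rewrite /transport !psiE bhom_linear fl bimod_map_linear.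
exists (c * C) => [|v]; first by rewrite mulr_ge0.
apply: le_trans (Lc _) _; rewrite -mulrA ler_wpM2l //.
apply: le_trans (fC _) _; rewrite ler_wpM2l // ler_prod // => i _.
by rewrite normr_ge0 ler_norm_bhom.
Qed.

(** Multiplicativity of [psi] handles the inner merges, compatibility of [L] with the actions the
    two outer terms. *)
Lemma hdiff_transport n (f : ('I_n -> D2) -> Y2) (v : 'I_n.+1 -> D1) :
  hdiff_fun (transport f) v = transport (hdiff_fun f) v.
Proof.
have LD x y : L (x + y) = L x + L y.
  by have := bimod_map_linear L 1 x y; rewrite !scale1r.
have LZ k x : L (k *: x) = k *: L x.
  have := bimod_map_linear L k x 0.
  by rewrite (linear_pred0 (bimod_map_linear L)) !addr0.
rewrite /transport /hdiff_fun !LD (linear_pred_sum (bimod_map_linear L)) LZ.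
rewrite bimod_map_lact bimod_map_ract; congr (_ + _ + _).
apply: eq_bigr => k _; rewrite LZ; congr (_ *: L (f _)).
by apply/funext => j; rewrite /merge_at; case: ifP => _ //; rewrite bhomM.
Qed.

Definition cochain_map n : cochain Y2 n -> cochain Y1 n :=
  if n is m.+1 then fun f : bmlin Y2 m.+1 => Bmlin (transport_bmlin f) else L.

Lemma cochain_map_linear n : linear (@cochain_map n).
Proof.
case: n => [|n]; first exact: bimod_map_linear.
by move=> k f g; apply: val_inj; apply/funext => v; exact: bimod_map_linear.
Qed.

Lemma coboundary_cochain_map n (f : cochain Y2 n) :
  coboundary (cochain_map f) = cochain_map (coboundary f).
Proof.
case: n f => [|n] f; apply: val_inj; apply/funext => v;
  last exact: hdiff_transport.
rewrite /= /transport /hdiff0_fun (linear_predB (bimod_map_linear L)).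
by rewrite bimod_map_lact bimod_map_ract.
Qed.

Lemma cocycle_map_subproof n (f : cocycle Y2 n) :
  cocycle_pred (cochain_map (val f)).
Proof.
apply/eqP; rewrite coboundary_cochain_map (eqP (valP f)).
exact: linear_pred0 (@cochain_map_linear _).
Qed.

Definition cocycle_map n (f : cocycle Y2 n) : cocycle Y1 n :=
  Cocycle (cocycle_map_subproof f).

Lemma cocycle_map_linear n : linear (@cocycle_map n).
Proof. by move=> k f g; apply: val_inj; exact: cochain_map_linear. Qed.

Lemma is_coboundary_cochain_map n (f : cochain Y2 n) :
  is_coboundary f -> is_coboundary (cochain_map f).
Proof.
case: n f => [|n] f /=; first by move=> ->;
  exact: linear_pred0 (bimod_map_linear L).
by move=> [g ->]; exists (cochain_map g); rewrite coboundary_cochain_map.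
Qed.

End CochainMap.

Section CochainMapComposition.
Variables (K : numFieldType) (D1 D2 D3 : banachAlgType K).
Variables (psi : banachHom D1 D2) (psi' : banachHom D2 D3).
Variables (Y1 : banachBimodType D1 D1) (Y2 : banachBimodType D2 D2).
Variables (Y3 : banachBimodType D3 D3).
Variables (L : bimodMap psi Y2 Y1) (L' : bimodMap psi' Y3 Y2).

Lemma cochain_map_comp0 n (f : cochain Y3 n) :
  (forall y, L (L' y) = 0) -> cochain_map L (cochain_map L' f) = 0.
Proof.
move=> LL'; case: n f => [|n] f /=; first exact: LL'.
by apply: val_inj; apply/funext => v; exact: LL'.
Qed.

End CochainMapComposition.

(** Applied with [L'] the inclusion of a corner and [L] the projection onto it: restriction undoes
    inflation. *)
Lemma cochain_mapK (K : numFieldType) (D1 D2 : banachAlgType K)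
    (psi : banachHom D1 D2) (psi' : banachHom D2 D1)
    (Y1 : banachBimodType D1 D1) (Y2 : banachBimodType D2 D2)
    (L : bimodMap psi Y2 Y1) (L' : bimodMap psi' Y1 Y2) n (f : cochain Y1 n) :
    cancel psi psi' -> cancel L' L ->
  cochain_map L (cochain_map L' f) = f.
Proof.
move=> psiK L'K; case: n f => [|n] f /=; first exact: L'K.
apply: val_inj; apply/funext => v; rewrite /= /transport L'K.
congr (bmlin_fun f _).
by apply/funext => i; rewrite psiK.
Qed.

(** * Projection onto a corner and its inclusion *)

Section Corner.
Variables (K : numFieldType) (A D : banachAlgType K).
Variables (phi : banachHom A D) (X : banachBimodType D D).
Local Notation e := (phi bone).

Lemma corner_proj_subproof (x : X) : corner_pred phi (ract (lact e x) e).
Proof. by apply/mem_set; exists x. Qed.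

Definition corner_proj_fun (x : X) : corner phi X :=
  Corner (corner_proj_subproof x).

Lemma corner_proj_linear : linear corner_proj_fun.
Proof. by move=> k x y; apply: val_inj; exact: bimod_linear. Qed.

Lemma corner_proj_lact a x :
  corner_proj_fun (lact (phi a) x) = lact a (corner_proj_fun x).
Proof.
by apply: val_inj; rewrite /= lactA -!lactM -!bhomM bmul1l bmul1r.
Qed.

Lemma corner_proj_ract x a :
  corner_proj_fun (ract x (phi a)) = ract (corner_proj_fun x) a.
Proof.
by apply: val_inj; rewrite /= -!lactA -!ractM -!bhomM bmul1l bmul1r.
Qed.

Lemma corner_proj_bounded :
  exists2 c : K, 0 <= c & forall x, `|corner_proj_fun x| <= c * `|x|.
Proof.
exists (`|e| * `|e|) => [|x]; first by rewrite mulr_ge0.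
rewrite corner_normE /=; apply: le_trans (ler_norm_ract _ _) _.
by rewrite mulrC -mulrA ler_wpM2l // ler_norm_lact.
Qed.

Definition corner_proj : bimodMap phi X (corner phi X) :=
  BimodMap corner_proj_linear corner_proj_lact corner_proj_ract
    corner_proj_bounded.

Lemma corner_proj_val x : corner_proj (val x) = x.
Proof.
by apply: val_inj => /=; case: x => x /= /cornerP[ex xe]; rewrite ex xe.
Qed.

Section Inclusion.
Variable psi : banachHom D A.
Hypothesis lact_psi : forall d (x : corner phi X),
  lact (phi (psi d)) (val x) = lact d (val x).
Hypothesis ract_psi : forall (x : corner phi X) d,
  ract (val x) (phi (psi d)) = ract (val x) d.

Lemma corner_val_linear : linear (val : corner phi X -> X).
Proof. by []. Qed.

Lemma corner_val_bounded :
  exists2 c : K, 0 <= c & forall x : corner phi X, `|val x| <= c * `|x|.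
Proof. by exists 1 => // x; rewrite mul1r corner_normE. Qed.

(** Inflation of cochains from [A] to [D] uses this map; the section hypotheses say that [D] acts on
    the corner through [psi]. *)
Definition corner_incl : bimodMap psi (corner phi X) X :=
  BimodMap corner_val_linear (fun d x => lact_psi d x) (fun x d => ract_psi x d)
    corner_val_bounded.

End Inclusion.
End Corner.

(** * Corners of the triangular algebra and the decomposition of cocycles *)

Section Triangular.
Variables (K : numFieldType) (A B : banachAlgType K).
Variable M : unitalBanachBimodType A B.
Local Notation T := (triangular M).

Lemma ulmx_linear : linear (ulmx : T -> A). Proof. by []. Qed.
Lemma lrmx_linear : linear (lrmx : T -> B). Proof. by []. Qed.
Lemma ulmxM : {morph (ulmx : T -> A) : s t / bmul s t}. Proof. by []. Qed.
Lemma lrmxM : {morph (lrmx : T -> B) : s t / bmul s t}. Proof. by []. Qed.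
Lemma ler_norm_ulmx (t : T) : `|ulmx t| <= `|t|.
Proof. by rewrite tri_normE -addrA lerDl addr_ge0. Qed.
Lemma ler_norm_lrmx (t : T) : `|lrmx t| <= `|t|.
Proof. by rewrite tri_normE lerDr addr_ge0. Qed.

Definition projA : banachHom T A := BanachHom ulmx_linear ulmxM ler_norm_ulmx.
Definition projB : banachHom T B := BanachHom lrmx_linear lrmxM ler_norm_lrmx.

Local Notation eA := (embA M bone).
Local Notation eB := (embB M bone).

Lemma bmul_eAl t : bmul eA t = TriMx (ulmx t) (urmx t) 0.
Proof. by congr TriMx; rewrite /= ?bmul1l ?lact1 ?ract0l ?bmul0l ?addr0. Qed.
Lemma bmul_eAr t : bmul t eA = TriMx (ulmx t) 0 0.
Proof. by congr TriMx; rewrite /= ?bmul1r ?lact0r ?ract0r ?bmul0r ?addr0. Qed.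
Lemma bmul_eBl t : bmul eB t = TriMx 0 0 (lrmx t).
Proof. by congr TriMx; rewrite /= ?bmul1l ?lact0l ?ract0l ?bmul0l ?addr0. Qed.
Lemma bmul_eBr t : bmul t eB = TriMx 0 (urmx t) (lrmx t).
Proof. by congr TriMx; rewrite /= ?bmul1r ?lact0r ?ract1 ?bmul0r ?add0r. Qed.
Lemma eA_idem : bmul eA eA = eA. Proof. by rewrite -bhomM bmul1l. Qed.
Lemma eB_idem : bmul eB eB = eB. Proof. by rewrite -bhomM bmul1l. Qed.
Lemma eAB1 : eA + eB = bone :> T.
Proof. by congr TriMx; rewrite /= ?addr0 ?add0r. Qed.
Lemma eBTeA t : bmul (bmul eB t) eA = 0.
Proof. by rewrite bmul_eBl bmul_eAr. Qed.
Lemma eATeA t : bmul (bmul eA t) eA = embA M (projA t).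
Proof. by rewrite bmul_eAl bmul_eAr. Qed.
Lemma eBTeB t : bmul (bmul eB t) eB = embB M (projB t).
Proof. by rewrite bmul_eBl bmul_eBr. Qed.
Lemma eBeA : bmul eB eA = 0. Proof. by rewrite bmul_eBl. Qed.
Lemma eAeB : bmul eA eB = 0. Proof. by rewrite bmul_eAl. Qed.

Variable X : unitalBanachBimodType T T.
Hypothesis X_AB0 : forall x : X, ract (lact eA x) eB = 0.

Lemma lact_projA t (x : corner (embA M) X) :
  lact (embA M (projA t)) (val x) = lact t (val x).
Proof.
case: x => x /= /cornerP[ex _]; rewrite -{2}ex -lactM bmul_eAr.
by [].
Qed.
Lemma ract_projA (x : corner (embA M) X) t :
  ract (val x) (embA M (projA t)) = ract (val x) t.
Proof.
case: x => x /= /cornerP[ex xe]; rewrite -{2}xe -ractM.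
(* The off-diagonal part of [bmul eA t] sends the corner into [e_A X e_B], which is zero. *)
have -> : bmul eA t = embA M (projA t) + bmul (bmul eA t) eB.
  by rewrite bmul_eAl bmul_eBr; congr TriMx; rewrite /= ?addr0 ?add0r.
by rewrite ractDr ractM -{3}ex -lactA X_AB0 addr0.
Qed.

Lemma lact_projB t (x : corner (embB M) X) :
  lact (embB M (projB t)) (val x) = lact t (val x).
Proof.
case: x => x /= /cornerP[ex xe]; rewrite -{2}ex -lactM.
(* The off-diagonal part of [bmul t eB] likewise sends the corner into [e_A X e_B]. *)
have -> : bmul t eB = embB M (projB t) + bmul eA (bmul t eB).
  by rewrite bmul_eBr bmul_eAl; congr TriMx; rewrite /= ?addr0 ?add0r.
by rewrite lactDl lactM -{3}xe lactA lactA X_AB0 addr0.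
Qed.

Lemma ract_projB (x : corner (embB M) X) t :
  ract (val x) (embB M (projB t)) = ract (val x) t.
Proof. by case: x => x /= /cornerP[_ xe]; rewrite -{2}xe -ractM bmul_eBl. Qed.

Let inclA := corner_incl lact_projA ract_projA.
Let inclB := corner_incl lact_projB ract_projB.
Let cprojA := corner_proj (embA M) X.
Let cprojB := corner_proj (embB M) X.

Lemma cprojA_inclB x : cprojA (inclB x) = 0.
Proof.
apply: val_inj; case: x => x /= /cornerP[ex _].
by rewrite -ex -lactM eAeB lact0l ract0l.
Qed.

Lemma cprojB_inclA x : cprojB (inclA x) = 0.
Proof.
apply: val_inj; case: x => x /= /cornerP[ex _].
by rewrite -ex -lactM eBeA lact0l ract0l.
Qed.

Lemma corner_decomposition n (f : cochain X n) : coboundary f = 0 ->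
  is_coboundary (f - (cochain_map inclA (cochain_map cprojA f) +
                      cochain_map inclB (cochain_map cprojB f))).
Proof.
case: n f => [|n] f f0.
  (* In degree 0 only zero is a coboundary, so equality is required; it follows because a cocycle
     commutes with [eA]. *)
  apply/eqP; rewrite subr_eq0 /=; apply/eqP.
  have eAx : lact eA f = ract f eA.
    apply/eqP; rewrite -subr_eq0; apply/eqP.
    exact: (congr1 (fun g : bmlin X 1 => g (fun=> eA)) f0).
  rewrite -{1}(ract1 f) -{1}eAB1 ractDr; congr (_ + _).
    by rewrite -eAx -{1}eA_idem lactM -lactA -eAx.
  rewrite -{1}(lact1 f) -eAB1 lactDl ractDl X_AB0 add0r.
  by [].
have [g gE] := cocycle_peirce eA_idem eB_idem eAB1 eBTeA X_AB0 f0.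
exists g; apply: val_inj; apply/funext => v.
have -> : val (coboundary g) v = f v -
    (ract (lact eA (f (fun j => bmul (bmul eA (v j)) eA))) eA +
     ract (lact eB (f (fun j => bmul (bmul eB (v j)) eB))) eB).
  by rewrite gE addrC addKr.
congr (_ - (ract (lact _ (f _)) _ + ract (lact _ (f _)) _)).
  by apply/funext => j; rewrite eATeA.
by apply/funext => j; rewrite eBTeB.
Qed.


Lemma is_coboundaryD n (f g : cochain X n) :
  is_coboundary f -> is_coboundary g -> is_coboundary (f + g).
Proof.
case: n f g => [|n] f g /=; first by move=> -> ->; exact: addr0.
move=> [f' ->] [g' ->]; exists (f' + g').
exact/esym/(linearD (@coboundary K T X n)).
Qed.

Lemma triangular_cohomology n :
  lin_iso (cohomology n X)
    (cohomology n (corner (embA M) X) * cohomology n (corner (embB M) X))%type.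
Proof.
have cpAl := @cochain_map_linear _ _ _ _ _ _ cprojA n.
have cpBl := @cochain_map_linear _ _ _ _ _ _ cprojB n.
apply: (@quot_space_prod_iso _ _ _ _ _ _ _ _ _ _ (cocycle_map cprojA (n := n))
  (cocycle_map cprojB (n := n))); try exact: cocycle_map_linear.
  move=> f; split=> [/asboolP fb|[/asboolP fA /asboolP fB]].
    by split; apply/asboolP; exact: is_coboundary_cochain_map.
  apply/asboolP; have f0 := eqP (valP f).
  (* Inflation preserves coboundaries, so only the difference from the inflated restrictions is left
     to [corner_decomposition]. *)
  rewrite -(subrK (cochain_map inclA (cochain_map cprojA (val f)) +
                   cochain_map inclB (cochain_map cprojB (val f))) (val f)).
  apply: is_coboundaryD; first exact: corner_decomposition.
  by apply: is_coboundaryD; exact: is_coboundary_cochain_map.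
(* Each restriction recovers its own summand and kills the other, as [e_A] and [e_B] are
   orthogonal. *)
move=> g h; exists (cocycle_map inclA g + cocycle_map inclB h).
have D_A (f f' : cochain X n) : cochain_map cprojA (f + f') =
    cochain_map cprojA f + cochain_map cprojA f'.
  by have := cpAl 1 f f'; rewrite !scale1r.
have D_B (f f' : cochain X n) : cochain_map cprojB (f + f') =
    cochain_map cprojB f + cochain_map cprojB f'.
  by have := cpBl 1 f f'; rewrite !scale1r.
split; apply: val_inj; rewrite /=.
  rewrite D_A cochain_mapK ?cochain_map_comp0 ?addr0 //.
    exact: cprojA_inclB.
  exact: corner_proj_val.
rewrite D_B cochain_map_comp0 ?cochain_mapK ?add0r //.
  exact: corner_proj_val.
exact: cprojB_inclA.
Qed.

End Triangular.

Theorem theorem3p1 (K : numFieldType) (A B : banachAlgType K)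
    (M : unitalBanachBimodType A B)
    (X : unitalBanachBimodType (triangular M) (triangular M))
    (hX : [set ract (lact (embA M bone) x) (embB M bone) | x in [set: X]]
          = [set 0])
    (n : nat) :
  lin_iso (cohomology n X)
    (cohomology n (corner (embA M) X) * cohomology n (corner (embB M) X))%type.
Proof.
apply: triangular_cohomology => x.
by change ([set 0] (ract (lact (embA M bone) x) (embB M bone))); rewrite -hX; exists x.
Qed.
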